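(* Consider an atomic splittable flow over time game with information on exit times on a parallel-edge network with edge set $E$ from $s$ to $t$, player set $P$, supply rates $d_j>0$ and time horizon $H>0$. For $T\in\mathbb R_{\ge0}^E$ let $E'(T)=\{e\in E: T_e<H\}$. Then the strategy profile $(g_j)_{j\in P}$ given for all $j\in P$, $e\in E$ by $$g_{e,j}(\theta,T)=\begin{cases}\dfrac{\nu_e}{\sum_{e'\in E'(T)}\nu_{e'}}&\text{if } e\in E'(T),\\[2mm] 0&\text{if } E'(T)\ne\emptyset\text{ and } e\notin E'(T),\\[1mm] \dfrac{\nu_e}{\sum_{e'\in E}\nu_{e'}}&\text{if } E'(T)=\emptyset\end{cases}$$ is a Nash equilibrium.
   Context: Setting (parallel-edge network). $E$ is a finite nonempty set of parallel edges from $s$ to $t$, each $e\in E$ with transit time $\tau_e>0$ and capacity $\nu_e>0$. $P$ is a finite set of players, player $j$ having supply rate $d_j>0$, origin $s$ and destination $t$; $H>0$ is the time horizon. Feasible flow over time. A flow over time is a family of nonnegative Lebesgue-integrable functions $f^+_{e,j}$ (inflow rate of player $j$ into $e$, on $[0,H)$) and $f^-_{e,j}$ (outflow rate of player $j$ from $e$, on $[0,H+\tau_e)$). Put $F^\pm_{e,j}(\theta)=\int_0^\theta f^\pm_{e,j}(\vartheta)\,d\vartheta$. The queue length is $z_e(\theta)=\sum_{j\in P}F^+_{e,j}(\theta)-\sum_{j\in P}F^-_{e,j}(\theta+\tau_e)$ and the exit time is $T_e(\theta)=\theta+z_e(\theta)/\nu_e+\tau_e$, for $\theta\in[0,H)$.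 The flow is feasible if for all $e\in E$, $j\in P$: (1) $\sum_{e\in E}f^+_{e,j}(\theta)=d_j$ for almost all $\theta\in[0,H)$; (2) $F^+_{e,j}(\theta)-F^-_{e,j}(\theta+\tau_e)\ge 0$ for all $\theta\in[0,H)$; (3) for almost all $\theta\in[0,H)$, $\sum_{j}f^-_{e,j}(\theta+\tau_e)$ equals $\nu_e$ if $z_e(\theta)>0$, and equals $\min\{\sum_j f^+_{e,j}(\theta),\nu_e\}$ otherwise; (4) for almost all $\theta\in[0,H+\tau_e)$, with $\varphi=\max T_e^{-1}(\theta)$, $f^-_{e,j}(\theta)=\frac{f^+_{e,j}(\varphi)}{\sum_{j'}f^+_{e,j'}(\varphi)}\sum_{j'}f^-_{e,j'}(\theta)$ if $\sum_{j'}f^+_{e,j'}(\varphi)>0$, and $f^-_{e,j}(\theta)=0$ otherwise (for $\theta<\tau_e$, where $\varphi$ would be negative, inflow rates are taken to be $0$, so $f^-_{e,j}(\theta)=0$). Game with information on exit times. Let $\mathcal I=[0,H)\times\mathbb R_{\ge0}^E$. A strategy of player $j$ is a function $g_j=(g_{e,j})_{e\in E}:\mathcal I\to[0,1]^E$ with $\sum_{e\in E}g_{e,j}(I)=1$ for all $I\in\mathcal I$, such that each $g_{e,j}$ is right-Lipschitz: for every $I\in\mathcal I$ there exist $L>0$ and $\varepsilon>0$ with $|g_{e,j}(I)-g_{e,j}(I+x)|\le L\|x\|$ for all $x\in[0,\varepsilon]\times[0,\varepsilon]^E$ (with $I+x\in\mathcal I$). A strategy profile $g=(g_j)_{j\in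 P}$ induces the unique (up to a null set) feasible flow over time satisfying $f^+_{e,j}(\theta)=g_{e,j}(\theta,T(\theta))\,d_j$ for almost all $\theta\in[0,H)$, $e\in E$, $j\in P$, where $T(\theta)=(T_e(\theta))_{e\in E}$. The payoff of player $j$, to be maximized, is $\rho_j=\sum_{e\in E}F^-_{e,j}(H)$. A (pure) Nash equilibrium is a strategy profile in which no player can strictly increase her payoff by unilaterally switching to another strategy. *)

(* Defs.v *)
From HB Require Import structures.
From mathcomp Require Export all_boot all_order all_algebra.
From mathcomp Require Export all_classical all_reals all_analysis.

Set Implicit Arguments.
Unset Strict Implicit.
Unset Printing Implicit Defensive.

Import Order.TTheory GRing.Theory Num.Theory.
Import numFieldNormedType.Exports.

Local Open Scope classical_set_scope.
Local Open Scope ring_scope.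

(* All functions of time are total on R.  Only the values of inflow rates on
   [0, H), of outflow rates of e on [0, H + tau e), and of strategies on
   [0, H) x R_{>=0}^E are ever constrained or used. *)

Record flow (R : realType) (E P : finType) := Flow {
  inflow : E -> P -> R -> R;
  outflow : E -> P -> R -> R
}.

Section FlowOverTime.
Variables (R : realType) (E P : finType).
Variables (tau nu : E -> R) (d : P -> R) (H : R).
Implicit Types (f : flow R E P) (e : E) (j : P) (theta phi : R).

Notation leb := (@lebesgue_measure R).

Definition cum_inflow f e j theta : R :=
  (\int[leb]_(x in `[0, theta]) inflow f e j x)%R.

Definition cum_outflow f e j theta : R :=
  (\int[leb]_(x in `[0, theta]) outflow f e j x)%R.

Definition total_inflow f e theta : R := \sum_j inflow f e j theta.

Definition total_outflow f e theta : R := \sum_j outflow f e j theta.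

Definition queue f e theta : R :=
  \sum_j cum_inflow f e j theta - \sum_j cum_outflow f e j (theta + tau e).

Definition exit_time f e theta : R := theta + queue f e theta / nu e + tau e.

(* phi = max T_e^{-1}(theta), where T_e has domain [0, H).  The maximum need
   not exist: the preimage is empty when theta < tau e. *)
Definition last_entry f e theta phi : Prop :=
  let preim := [set x | 0 <= x < H /\ exit_time f e x = theta] in
  preim phi /\ ubound preim phi.

Definition flow_over_time f : Prop :=
  forall e j,
  [/\ leb.-integrable `[0, H[ (EFin \o inflow f e j),
      leb.-integrable `[0, H + tau e[ (EFin \o outflow f e j),
      (forall theta, 0 <= theta < H -> 0 <= inflow f e j theta) &
      (forall theta, 0 <= theta < H + tau e -> 0 <= outflow f e j theta)].

Definition supply_constraint f : Prop :=
  forall j, {ae leb, forall theta, 0 <= theta < H ->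
    \sum_e inflow f e j theta = d j}.

Definition no_deficit f : Prop :=
  forall e j theta, 0 <= theta < H ->
    0 <= cum_inflow f e j theta - cum_outflow f e j (theta + tau e).

Definition queue_operation f : Prop :=
  forall e, {ae leb, forall theta, 0 <= theta < H ->
    total_outflow f e (theta + tau e) =
      if 0 < queue f e theta then nu e
      else Num.min (total_inflow f e theta) (nu e)}.

(* The second clause also covers the times theta at which max T_e^{-1}(theta)
   does not exist. *)
Definition fifo_operation f : Prop :=
  forall e j, {ae leb, forall theta, 0 <= theta < H + tau e ->
    (forall phi, last_entry f e theta phi -> 0 < total_inflow f e phi ->
       outflow f e j theta =
         inflow f e j phi / total_inflow f e phi * total_outflow f e theta) /\
    (~ (exists phi, last_entry f e theta phi /\ 0 < total_inflow f e phi) ->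
       outflow f e j theta = 0)}.

Definition feasible f : Prop :=
  [/\ flow_over_time f, supply_constraint f, no_deficit f,
      queue_operation f & fifo_operation f].

Definition strategy := R -> (E -> R) -> E -> R.

Definition information theta (T : E -> R) : Prop :=
  0 <= theta < H /\ forall e, 0 <= T e.

(* Euclidean norm on R x R^E; since L below is existentially quantified, the
   choice of the norm is immaterial. *)
Definition info_norm (x0 : R) (x : E -> R) : R :=
  Num.sqrt (x0 ^+ 2 + \sum_e x e ^+ 2).

Definition right_lipschitz (u : R -> (E -> R) -> R) : Prop :=
  forall theta T, information theta T ->
  exists L eps : R, [/\ 0 < L, 0 < eps &
    forall (x0 : R) (x : E -> R),
      0 <= x0 <= eps -> (forall e, 0 <= x e <= eps) ->
      information (theta + x0) (fun e => T e + x e) ->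
      `|u theta T - u (theta + x0) (fun e => T e + x e)|
        <= L * info_norm x0 x].

Definition is_strategy (s : strategy) : Prop :=
  (forall theta T, information theta T ->
     (forall e, 0 <= s theta T e <= 1) /\ \sum_e s theta T e = 1) /\
  (forall e, right_lipschitz (fun theta T => s theta T e)).

Definition profile := P -> strategy.

Definition is_profile (g : profile) : Prop := forall j, is_strategy (g j).

Definition induced (g : profile) f : Prop :=
  feasible f /\
  forall e j, {ae leb, forall theta, 0 <= theta < H ->
    inflow f e j theta =
      g j theta (fun e' => exit_time f e' theta) e * d j}.

Definition payoff f j : R := \sum_e cum_outflow f e j H.

Definition deviation (g : profile) j (s : strategy) : profile :=
  fun i => if i == j then s else g i.

(* "The" flow induced by a profile is only determined up to null sets, so
   payoffs are compared for all flows induced by g and by the deviation. *)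
Definition nash_equilibrium (g : profile) : Prop :=
  is_profile g /\
  forall j (s : strategy), is_strategy s ->
  forall f f', induced g f -> induced (deviation g j s) f' ->
    payoff f' j <= payoff f j.

(* The edges e with T e < H are those of E'(T). *)
Definition proportional_strategy : strategy := fun theta T e =>
  if T e < H then nu e / \sum_(e' | T e' < H) nu e'
  else if [exists e', T e' < H] then 0
  else nu e / \sum_e' nu e'.

End FlowOverTime.

(* Main.v *)
(* The exit times of an edge are nondecreasing, so edge e is useful (exit time
   below H) exactly up to a cutoff time c_e, and by FIFO a player receives from
   e what she has sent into e before c_e.  With m = max_e c_e, a proportional
   player i, who only ever uses useful edges while there are some, receives
   d_i m, and any player j receives at most d_j m.

   Moreover, the all-proportional flow maximizes, among all feasible flows, the
   total amount arriving before H.  Indeed, every feasible flow delivers at most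
   D t + sum_e nu_e max(0, H - t - tau_e), for every t, with D the total supply.
   If t is the time from which D exceeds the capacity of the useful edges, the
   all-proportional flow attains this bound: it has no queues up to t, and after
   t it keeps every useful edge saturated.

   Let j deviate, and let m' be the new maximal cutoff.  If m' <= m, player j
   receives at most d_j m' <= d_j m.  Otherwise the others receive
   d_i m' > d_i m while the total does not increase, so j does not gain. *)
From HB Require Import structures.
Require Import Defs.
From mathcomp Require Import all_boot all_order all_algebra.
From mathcomp Require Import all_classical all_reals all_analysis.
From mathcomp Require Import measurable_realfun lra ring.
Set Implicit Arguments.
Unset Strict Implicit.
Unset Printing Implicit Defensive.
Import Order.TTheory GRing.Theory Num.Theory.
Import numFieldNormedType.Exports.
Local Open Scope classical_set_scope.
Local Open Scope ring_scope.

(** * Integration: densities, primitives, null sets *)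

Section density.
Local Open Scope ereal_scope.
Context d (T : measurableType d) (R : realType).
Variables (mu : {measure set T -> \bar R}) (q : T -> R).
Variables (mq : measurable_fun setT q) (q0 : forall x, (0 <= q x)%R).

(** The two proofs are arguments so that the measure structure below can be attached to [density]
    itself. *)
Definition density of measurable_fun setT q & (forall x, (0 <= q x)%R) :=
  fun A : set T => \int[mu]_(x in A) (q x)%:E.

Local Notation nu := (density mq q0).

Let density0 : nu set0 = 0. Proof. exact: integral_set0. Qed.

Let density_ge0 A : 0 <= nu A.
Proof. by apply: integral_ge0 => x _; rewrite lee_fin. Qed.

Let density_sigma_additive : semi_sigma_additive nu.
Proof.
by apply: semi_sigma_additive_nng_induced => //; exact/measurable_EFinP.
Qed.

HB.instance Definition _ := isMeasure.Build _ _ _ nu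
  density0 density_ge0 density_sigma_additive.

Import HBNNSimple.

(** Approximation from below by simple functions and monotone convergence on both sides reduce the
    identity to indicators, where it is the definition of [density]. *)
Lemma ge0_integral_density (g : T -> \bar R) :
  measurable_fun setT g -> (forall x, 0 <= g x) ->
  \int[nu]_x g x = \int[mu]_x (g x * (q x)%:E).
Proof.
move=> mg g0; pose h := nnsfun_approx measurableT mg.
have hg x : (EFin \o h n) x @[n --> \oo] --> g x.
  by apply: cvg_nnsfun_approx => // y _.
have nd_h x a b : (a <= b)%N -> (h a x <= h b x)%R.
  by move=> ab; exact/lefP/nd_nnsfun_approx.
have mEq : measurable_fun setT (EFin \o q) by exact/measurable_EFinP.
have mh n : measurable_fun setT (EFin \o h n).
  exact/measurable_EFinP/measurable_funP.
transitivity (limn (fun n => \int[nu]_x (h n x)%:E)).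
  rewrite -monotone_convergence//.
  - by apply: eq_integral => x _; apply/esym/cvg_lim => //; exact: hg.
  - by move=> n x _; rewrite lee_fin.
  - by move=> x _ a b ab; rewrite lee_fin nd_h.
transitivity (limn (fun n => \int[mu]_x ((h n x)%:E * (q x)%:E))); last first.
  rewrite -monotone_convergence//.
  - apply: eq_integral => x _; apply/cvg_lim => //.
    by apply: cvgeZr => //; exact: hg.
  - by move=> n; exact: (emeasurable_funM (mh n) mEq).
  - by move=> n x _; rewrite mule_ge0 ?lee_fin.
  - by move=> x _ a b ab; rewrite lee_wpmul2r ?lee_fin ?nd_h.
congr (limn _); apply/funext => n.
rewrite integralT_nnsfun sintegralE.
under [RHS]eq_integral => x _.
  rewrite (fimfunE (h n)) -fsumEFin// ge0_mule_fsuml; last first.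
    by move=> y; exact: nnfun_muleindic_ge0.
  over.
rewrite ge0_integral_fsum//; last 2 first.
  - move=> y; apply: emeasurable_funM => //.
    by apply/measurable_EFinP; exact: measurable_funM.
  - move=> m y Ey; apply: mule_ge0; last by rewrite lee_fin.
    exact: nnfun_muleindic_ge0.
apply: eq_fsbigr => r; rewrite inE => -[t _ rt].
under [RHS]eq_integral do rewrite EFinM -muleA.
rewrite ge0_integralZl//.
- congr (_ * _); rewrite /nu /density [LHS]integral_mkcond epatch_indic.
  by apply: eq_integral => x _; rewrite muleC.
- by apply: emeasurable_funM => //; exact/measurable_EFinP.
- by move=> x _; rewrite mule_ge0// lee_fin.
- by rewrite lee_fin -rt.
Qed.

End density.

(** * Image measures and change of variables *)

Section transport.
Context (R : realType).
Notation leb := (@lebesgue_measure R).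
Local Open Scope ereal_scope.

Lemma patch_ge0 (D : set R) (u : R -> R) :
  (forall x, D x -> (0 <= u x)%R) -> forall x, (0 <= (u \_ D) x)%R.
Proof.
move=> u0 x; rewrite patchE; case: ifPn => [/set_mem|_]; first exact: u0.
by rewrite /point.
Qed.

Lemma measurable_patch (D : set R) (u : R -> R) :
  measurable D -> measurable_fun D u -> measurable_fun setT (u \_ D).
Proof. by move=> mD mu; exact: (proj1 (measurable_restrictT u mD) mu). Qed.

(* [phi] pushes the measure of density [q] on [D1] to that of density [p] on
   [D2], because the two agree on rays. *)
Lemma ge0_integral_transport (D1 D2 : set R) (q p r phi : R -> R) :
  measurable D1 -> measurable D2 ->
  leb.-integrable D1 (EFin \o q) -> measurable_fun D2 p ->
  (forall x, D1 x -> (0 <= q x)%R) -> (forall x, D2 x -> (0 <= p x)%R) ->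
  measurable_fun setT phi -> (forall x, D1 x -> D2 (phi x)) ->
  (forall a, \int[leb]_(x in D1 `&` phi @^-1` `]-oo, a[) (q x)%:E =
             \int[leb]_(x in D2 `&` `]-oo, a[) (p x)%:E) ->
  measurable_fun D2 r -> (forall x, D2 x -> (0 <= r x)%R) ->
  \int[leb]_(x in D1) (r (phi x) * q x)%:E = \int[leb]_(x in D2) (r x * p x)%:E.
Proof.
move=> mD1 mD2 iq mp q0 p0 mphi phiD rays mr r0.
have mq : measurable_fun D1 q.
  by apply/measurable_EFinP; exact: (measurable_int leb).
pose q' := q \_ D1; pose p' := p \_ D2; pose r' := r \_ D2.
have mq' : measurable_fun setT q' by exact: measurable_patch.
have mp' : measurable_fun setT p' by exact: measurable_patch.
have mr' : measurable_fun setT r' by exact: measurable_patch.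
have q'0 := patch_ge0 q0 : forall x, (0 <= q' x)%R.
have p'0 := patch_ge0 p0 : forall x, (0 <= p' x)%R.
have r'0 := patch_ge0 r0 : forall x, (0 <= r' x)%R.
have mphi0 := mphi; pose push := (pushforward (density leb mq' q'0)
  (phi : measurableTypeR R -> measurableTypeR R)
  : {measure set (measurableTypeR R) -> \bar R}).
pose m1 := push mphi.
pose m2 : {measure set (measurableTypeR R) -> \bar R} := density leb mp' p'0.
have restr (D A : set R) (u : R -> R) :
    \int[leb]_(x in A) ((u \_ D) x)%:E = \int[leb]_(x in D `&` A) (u x)%:E.
  rewrite [RHS]integral_mkcondl; apply: eq_integral => x _.
  by rewrite !patchE; case: ifPn.
(* Open left rays generate the Borel sets, are closed under intersection and exhaust the line, and
   [m1] is finite on them since [q] is integrable; so agreement on rays suffices. *)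
have m12 (A : set (measurableTypeR R)) : measurable A -> m1 A = m2 A.
  apply: (@measure_unique _ R (measurableTypeR R)
      [set A | exists x, A = `]-oo, x[%classic]
      (fun n => `]-oo, (n%:R : R)[%classic) _ _ _ _ m1 m2) => //.
  - exact: RGenInftyO.measurableE.
  - move=> _ _ [a ->] [b ->]; exists (Num.min a b).
    by apply/seteqP; split => x /=; rewrite !in_itv/= lt_min => /andP.
  - by move=> n; exists n%:R.
  - apply/seteqP; split => // x _; exists (Num.truncn x).+1 => //=.
    by rewrite in_itv/= truncnS_gt.
  - by move=> _ [a ->]; rewrite /m1 /m2 /= /pushforward /density !restr rays.
  - move=> n; rewrite /m1 /= /pushforward /density restr.
    have mphin : measurable (phi @^-1` `]-oo, (n%:R : R)[).
      by rewrite -[X in measurable X]setTI; apply: mphi0.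
    rewrite (@le_lt_trans _ _ (\int[leb]_(x in D1) (q x)%:E))//.
      apply: ge0_subset_integral => //.
      - exact: measurableI.
      - exact/measurable_EFinP.
    by rewrite ltey_eq integrable_fin_num.
have eq_m : \int[m1]_x (r' x)%:E = \int[m2]_x (r' x)%:E.
  by apply: eq_measure_integral => A mA _; exact: m12.
have mEr' : measurable_fun setT (EFin \o r') by exact/measurable_EFinP.
move: eq_m; rewrite [in RHS]ge0_integral_density//.
rewrite /m1 ge0_integral_pushforward//.
rewrite preimage_setT ge0_integral_density//; last first.
- by move=> x; rewrite /= lee_fin.
- by apply: measurableT_comp => //; exact: mEr'.
- move=> eq_m; transitivity (\int[leb]_x (((EFin \o r') \o phi) x * (q' x)%:E)).
    rewrite [LHS]integral_mkcond; apply: eq_integral => x _.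
    rewrite /= /q' /r' !patchE -EFinM; case: ifPn => [/set_mem D1x|_].
      by rewrite mem_set//; exact: phiD.
    by rewrite mulr0.
  rewrite eq_m [RHS]integral_mkcond; apply: eq_integral => x _.
  rewrite /= /p' /r' !patchE -EFinM; case: ifPn => // _.
  by rewrite mulr0.
- by move=> x _; rewrite lee_fin.
Qed.
End transport.

(** * Primitives of integrable rates *)

Section primitive.
Context (R : realType).
Notation leb := (@lebesgue_measure R).
Implicit Types (u v : R -> R) (a b c B : R).

(** The image of Lebesgue measure under a translation agrees with it on half-open intervals, so
    translations preserve null sets. Needed to pass between entry times and times shifted by the
    transit time. *)
Lemma ae_shift (Q : R -> Prop) c :
  {ae leb, forall x, Q x} -> {ae leb, forall x, Q (x + c)}.
Proof.
move=> [N [mN N0 QN]].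
have mc : measurable_fun [set: measurableTypeR R]
    ((fun x => x + c) : measurableTypeR R -> measurableTypeR R).
  exact: measurable_funD.
have mc0 := mc.
pose push := (pushforward leb
  ((fun x => x + c) : measurableTypeR R -> measurableTypeR R)
  : {measure set (measurableTypeR R) -> \bar R}).
exists ((fun x => x + c) @^-1` N); split.
- by rewrite -[X in measurable X]setTI; exact: mc0.
- rewrite -[LHS]/(push mc N) -(@lebesgue_measure_unique R (push mc))//.
  move=> _ [[x y] _ <-] /=; rewrite /pushforward.
  rewrite (_ : _ @^-1` _ = `]x - c, y - c]%classic).
    rewrite !lebesgue_measure_itv/= !lte_fin ltrD2r.
    by case: ifPn => // _; rewrite -!EFinB; congr (_%:E); lra.
  by apply/seteqP; split => z /=; rewrite !in_itv/= => /andP[? ?];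
    apply/andP; split; lra.
- by move=> x nQ; apply: (QN (x + c)).
Qed.

Lemma ae_mono (P Q : R -> Prop) : (forall x, P x -> Q x) ->
  {ae leb, forall x, P x} -> {ae leb, forall x, Q x}.
Proof. by move=> PQ; apply: negligibleS => x /= nQ /PQ. Qed.

Lemma ae_mono2 (P1 P2 Q : R -> Prop) : (forall x, P1 x -> P2 x -> Q x) ->
  {ae leb, forall x, P1 x} -> {ae leb, forall x, P2 x} ->
  {ae leb, forall x, Q x}.
Proof.
move=> PQ n1 n2; apply: negligibleS (negligibleU n1 n2) => x /= nQ.
by apply: contrapT => /not_orP[/contrapT P1x /contrapT P2x]; exact/nQ/PQ.
Qed.

(** [cum_inflow] and [cum_outflow] are instances by conversion. *)
Definition prim u b : R := (\int[leb]_(x in `[0, b]) u x)%R.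

Lemma integrable_sub u B (D : set R) : measurable D -> D `<=` `[0, B[ ->
  leb.-integrable `[0, B[ (EFin \o u) -> leb.-integrable D (EFin \o u).
Proof. by move=> mD DB; apply: integrableS. Qed.

Lemma prim0 u : prim u 0 = 0.
Proof. by rewrite /prim set_itv1 Rintegral_set1. Qed.

Lemma prim_diff u a b B : leb.-integrable `[0, B[ (EFin \o u) ->
  0 <= a -> a <= b -> b < B ->
  prim u b - prim u a = (\int[leb]_(x in `]a, b]) u x)%R.
Proof.
move=> iu a0 ab bB; apply: Rintegral_itvB; rewrite ?bnd_simp//.
by apply: integrable_sub iu => // x /=; rewrite !in_itv/=; lra.
Qed.

Lemma prim_le u v a b B : leb.-integrable `[0, B[ (EFin \o u) ->
  leb.-integrable `[0, B[ (EFin \o v) ->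
  0 <= a -> a <= b -> b < B ->
  {ae leb, forall x, a < x < b -> u x <= v x} ->
  prim u b - prim u a <= prim v b - prim v a.
Proof.
move=> iu iv a0 ab bB [N [mN N0 uvN]].
have sub : `]a, b[ `<=` `[0, B[ by move=> x /=; rewrite !in_itv/=; lra.
have subc : `]a, b] `<=` `[0, B[ by move=> x /=; rewrite !in_itv/=; lra.
rewrite !(prim_diff (B := B))//.
rewrite -!Rintegral_itv_bndo_bndc; do ?exact: integrable_sub sub _.
(* Removing the null set [N] changes neither integral, and off [N] the comparison holds
   pointwise. *)
have key w : leb.-integrable `[0, B[ (EFin \o w) ->
   (\int[leb]_(x in `]a, b[) w x = \int[leb]_(x in `]a, b[ `\` N) w x)%R.
  move=> iw; rewrite /Rintegral (negligible_integral mN)//.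
  exact: integrable_sub sub iw.
have subN : `]a, b[ `\` N `<=` `[0, B[ by move=> x [/sub].
have mDN : measurable (`]a, b[ `\` N) by exact: measurableD.
rewrite !key//; apply: le_Rintegral => //; do ?exact: (integrable_sub _ subN).
move=> x [xab Nx]; apply: contrapT => nle; apply: Nx; apply: uvN => /=.
by apply/not_implyP; split => //; move: xab => /=; rewrite in_itv.
Qed.

Lemma prim_cst c b : 0 <= b -> prim (fun=> c) b = c * b.
Proof.
move=> b0; rewrite /prim Rintegral_cst//.
have /= -> := @lebesgue_measure_itv R `[0, b].
rewrite lte_fin; case: ltP => [_|b0']; first by rewrite -EFinB /= subr0.
by rewrite (_ : b = 0) //; lra.
Qed.

Lemma integrable_cst c B : leb.-integrable `[0, B[ (EFin \o (fun=> c)).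
Proof.
apply/integrableP; split; first exact: measurable_cst.
rewrite (_ : (fun _ => _) = cst (`|c|%:E))// integral_cst//.
have /= -> := @lebesgue_measure_itv R `[0, B[.
by rewrite lte_fin; case: ifPn => _; rewrite ?mule0// -EFinB -EFinM ltry.
Qed.

Lemma prim_le_cst u c a b B : leb.-integrable `[0, B[ (EFin \o u) ->
  0 <= a -> a <= b -> b < B ->
  {ae leb, forall x, a < x < b -> u x <= c} ->
  prim u b - prim u a <= c * (b - a).
Proof.
move=> iu a0 ab bB h; have := prim_le iu (integrable_cst c B) a0 ab bB h.
by rewrite !prim_cst ?mulrBr//; lra.
Qed.

Lemma prim_ge_cst u c a b B : leb.-integrable `[0, B[ (EFin \o u) ->
  0 <= a -> a <= b -> b < B ->
  {ae leb, forall x, a < x < b -> c <= u x} ->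
  c * (b - a) <= prim u b - prim u a.
Proof.
move=> iu a0 ab bB h; have := prim_le (integrable_cst c B) iu a0 ab bB h.
by rewrite !prim_cst ?mulrBr//; lra.
Qed.

Lemma prim_eq_cst u c a b B : leb.-integrable `[0, B[ (EFin \o u) ->
  0 <= a -> a <= b -> b < B ->
  {ae leb, forall x, a < x < b -> u x = c} ->
  prim u b - prim u a = c * (b - a).
Proof.
move=> iu a0 ab bB h; apply/eqP; rewrite eq_le.
rewrite (prim_le_cst iu)//= ?(prim_ge_cst iu)//.
  by apply: ae_mono h => x h /h ->.
by apply: ae_mono h => x h /h ->.
Qed.

Lemma integrable_sumr (I : finType) (u : I -> R -> R) (D : set R) :
  measurable D -> (forall i, leb.-integrable D (EFin \o u i)) ->
  leb.-integrable D (EFin \o (fun x => \sum_i u i x)).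
Proof.
move=> mD iu; rewrite (_ : _ \o _ = fun x => (\sum_i (u i x)%:E)%E).
  have := @integrable_sum _ _ _ leb D mD I (index_enum I) xpredT
    (fun i => EFin \o u i).
  by apply => i _; exact: iu.
by apply/funext => x /=; rewrite sumEFin.
Qed.

Lemma prim_sum (I : finType) (u : I -> R -> R) b B :
  (forall i, leb.-integrable `[0, B[ (EFin \o u i)) -> b < B ->
  \sum_i prim (u i) b = prim (fun x => \sum_i u i x) b.
Proof.
move=> iu bB; have iub i : leb.-integrable `[0, b] (EFin \o u i).
  by apply: integrable_sub (iu i) => // x /=; rewrite !in_itv/=; lra.
have mb : measurable (`[0, b] : set (measurableTypeR R)) by [].
rewrite /prim /Rintegral sum_fine => [|i _]; last first.
  exact: (integrable_fin_num mb (iub i)).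
have /= <- := @integral_sum _ _ _ leb _ mb I (fun i => EFin \o u i) iub
  (index_enum I) xpredT.
by congr fine; apply: eq_integral => x _; rewrite -sumEFin.
Qed.

Lemma prim_continuous u b B : leb.-integrable `[0, B[ (EFin \o u) ->
  0 <= b -> b < B -> {within `[0, b], continuous (prim u)}.
Proof.
move=> iu b0 bB; apply: (parameterized_integral_continuous b0).
by apply: integrable_sub iu => // x /=; rewrite !in_itv/=; lra.
Qed.

Lemma integral_itv_prim u a b B : leb.-integrable `[0, B[ (EFin \o u) ->
  0 <= a -> a <= b -> b < B ->
  (\int[leb]_(x in `[a, b[) (u x)%:E = (prim u b - prim u a)%:E)%E.
Proof.
move=> iu a0 ab bB.
have iD (D : set R) : measurable D -> D `<=` `[0, B[ ->
    leb.-integrable D (EFin \o u) by move=> mD DB; exact: integrable_sub DB iu.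
have sub1 : `]a, b] `<=` `[0, B[ by move=> x /=; rewrite !in_itv/=; lra.
have sub2 : `]a, b[ `<=` `[0, B[ by move=> x /=; rewrite !in_itv/=; lra.
rewrite (prim_diff iu)// /Rintegral fineK; last first.
  by apply: integrable_fin_num => //; exact: iD.
rewrite -integral_itv_obnd_cbnd; last by apply: (measurable_int leb); exact: iD.
by apply: integral_itv_bndo_bndc; apply: (measurable_int leb); exact: iD.
Qed.

End primitive.

(** * Inverses and shifts of real functions *)

Section real_lemmas.
Context (R : realType).
Implicit Types (T phi : R -> R) (a b c x y : R).

(** Inversion is continuous off 0, and on the remaining singleton any function is measurable. Used
    for the share of one player in the inflow of an edge. *)
Lemma measurable_inv : measurable_fun [set: R] (fun x : R => x^-1).
Proof.
have -> : [set: R] = [set x | x != 0] `|` [set 0].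
  by apply/seteqP; split => // x _ /=; case: eqVneq => [->|]; [right|left].
have open0 : open [set x : R | x != 0] by exact: open_neq.
apply/measurable_funU => //; first exact: open_measurable.
split; last exact: measurable_fun_set1.
apply: open_continuous_measurable_fun => // x; rewrite inE/=.
exact: inv_continuous.
Qed.

(** [phi x] is the supremum of the times [y] in [[0, b]] with [T y <= x], a total version of the
    last entry time. The final property turns preimages of rays under [phi] into intervals, as
    [ge0_integral_transport] requires. *)
Lemma nondecreasing_right_inverse T b : 0 <= b ->
  {within `[0, b], continuous T} ->
  (forall x y, 0 <= x -> x <= y -> y <= b -> T x <= T y) ->
  exists phi : R -> R, {homo phi : x y / x <= y} /\
    forall x, T 0 <= x -> x < T b -> 
    [/\ 0 <= phi x < b, T (phi x) = x,
        (forall y, 0 <= y <= b -> T y = x -> y <= phi x) &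
        (forall a, 0 <= a <= b -> (phi x < a) = (x < T a))].
Proof.
move=> b0 cT ndT.
pose S x := [set y | 0 <= y <= b /\ T y <= x].
have ubS x : has_ubound (S x) by exists b => y [/andP[_ ->]].
exists (fun x => sup (S x)); split.
  move=> x y xy; have [->|/set0P Sx0] := eqVneq (S x) set0.
    rewrite sup0; have [->|/set0P[t St]] := eqVneq (S y) set0.
      by rewrite sup0.
    case: (St) => /andP[t0 _] _; apply: (le_trans t0).
    exact: (ub_le_sup (ubS y)).
  apply: ge_sup => // s [sb Ts]; apply: (ub_le_sup (ubS y)).
  by split => //; exact: le_trans xy.
move=> x x0 xb.
have S0 : S x 0 by split => //; rewrite lexx b0.
have hsS : has_sup (S x) by split; [exists 0|exact: ubS].
set p := sup (S x).
have lep y : S x y -> y <= p by exact: (ub_le_sup (ubS x)).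
have p0 : 0 <= p by exact: lep.
have pb : p <= b by apply: ge_sup => //; [exists 0|move=> y [/andP[]]].
have [c /[!in_itv]/= cb Tc] : exists2 c, c \in `[0, b] & T c = x.
  apply: IVT => //; rewrite ge_min le_max x0 (ltW xb) orbT//.
have cp : c <= p by apply: lep; split => //; rewrite Tc.
have TpE : T p = x.
  apply/eqP; rewrite eq_le; apply/andP; split; last first.
    by rewrite -Tc; apply: ndT => //; case/andP: cb.
  (* If [T p > x], the intermediate value theorem gives a time [e < p] with [T e > x]; but some [y]
     past [e] has [T y <= x], since [p] is the supremum, against monotonicity. *)
  rewrite leNgt; apply/negP => xTp.
  have [e /[!in_itv]/= /andP[ce ep] Te] :
      exists2 e, e \in `[c, p] & T e = (x + T p) / 2.
    apply: IVT => //.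
      apply: continuous_subspaceW cT => z /=; rewrite !in_itv/=; lra.
    rewrite Tc ge_min le_max; apply/andP; split; apply/orP; [left|right]; lra.
  have ep' : e < p.
    rewrite lt_neqAle ep andbT; apply/eqP => ep'; move: Te; rewrite ep'; lra.
  have [|y Sy] := @sup_adherent _ (S x) (p - e) _ hsS.
    by rewrite subr_gt0.
  rewrite -/p => ey; have : T e <= T y.
    by apply: ndT; case: Sy => /andP[? ?] _; lra.
  case: Sy => _; lra.
have pltb : p < b.
  by rewrite lt_neqAle pb andbT; apply/eqP => pE; move: TpE; rewrite pE; lra.
split.
- by rewrite p0.
- exact: TpE.
- by move=> y yb Ty; apply: lep; split => //; rewrite Ty.
- move=> a /andP[a0 ab]; apply/idP/idP => h.
    rewrite ltNge; apply/negP => Ta; move: h; apply/negP; rewrite -leNgt.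
    by apply: lep; split => //; rewrite a0.
  rewrite ltNge; apply/negP => ap; move: h; apply/negP; rewrite -leNgt.
  by rewrite -TpE; apply: ndT.
Qed.

Lemma continuous_comp_shift (f : R -> R) b c e : 0 < c -> 0 <= b -> b + c < e ->
  {within `[0, e], continuous f} ->
  {within `[0, b], continuous (fun x => f (x + c))}.
Proof.
move=> c0 b0 bce cf.
have e0 : 0 < e by lra.
have [cf' _ _] := (continuous_within_itvP f e0).1 cf.
apply: (@within_continuous_comp _ _ _ `[0, b] (fun x => x + c) f).
  move=> y; rewrite inE/= => -[x /=]; rewrite in_itv/= => xb <-.
  by apply: cf'; rewrite in_itv/=; lra.
apply: continuous_subspaceT => x; apply: cvgD; [exact: cvg_id|exact: cvg_cst].
Qed.

End real_lemmas.

(** * The dynamics of a single edge *)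

Section edge.
Context (R : realType).
Notation leb := (@lebesgue_measure R).
Implicit Types (tau nu H a b c t x y : R) (uin uout : R -> R).

(** Built from aggregate rates, so that the dynamics of an edge never mention players;
    [total_queueE] makes the link with [queue]. *)
Definition queue_of tau uin uout x := prim uin x - prim uout (x + tau).

Definition exit_of tau nu uin uout x :=
  x + queue_of tau uin uout x / nu + tau.

(* The total inflow and outflow rates of one edge; times in [edge_operation] are
   shifted by [tau] with respect to the queue operation rule. *)
Record edge_flow tau nu H uin uout : Prop := EdgeFlow {
  edge_pos : [/\ 0 < tau, 0 < nu & 0 < H];
  edge_in : leb.-integrable `[0, H[ (EFin \o uin);
  edge_out : leb.-integrable `[0, H + tau[ (EFin \o uout);
  edge_in_ge0 : forall x, 0 <= x < H -> 0 <= uin x;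
  edge_out_ge0 : forall x, 0 <= x < H + tau -> 0 <= uout x;
  edge_queue_ge0 : forall x, 0 <= x < H -> 0 <= queue_of tau uin uout x;
  edge_start : {ae leb, forall x, 0 <= x < tau -> uout x = 0};
  edge_operation : {ae leb, forall x, tau <= x < H + tau ->
    uout x = if 0 < queue_of tau uin uout (x - tau) then nu
             else Num.min (uin (x - tau)) nu}
}.

Section dynamics.
Variables (tau nu H : R) (uin uout : R -> R).
Notation is_edge_flow := (edge_flow tau nu H uin uout).
Notation z := (queue_of tau uin uout).
Notation T := (exit_of tau nu uin uout).

Lemma outflow_le (ef : is_edge_flow) :
  {ae leb, forall x, tau <= x < H + tau -> uout x <= nu}.
Proof.
apply: ae_mono (edge_operation ef) => x h /h ->.
by case: ifPn => // _; rewrite ge_min lexx orbT.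
Qed.

Lemma prim_out_start (ef : is_edge_flow) : prim uout tau = 0.
Proof.
have [tau0 nu0 H0] := edge_pos ef.
have := prim_eq_cst (c := 0) (edge_out ef) (lexx 0) (ltW tau0).
rewrite prim0 mul0r subr0; apply; first by lra.
by apply: ae_mono (edge_start ef) => x h xt; apply: h; lra.
Qed.

Lemma prim_in_mono (ef : is_edge_flow) x y : 0 <= x -> x <= y -> y < H ->
  prim uin x <= prim uin y.
Proof.
move=> x0 xy yH; have := prim_ge_cst (c := 0) (edge_in ef) x0 xy yH.
rewrite mul0r subr_ge0; apply; apply: aeW => s sxy.
by apply: (edge_in_ge0 ef); lra.
Qed.

Lemma prim_out_mono (ef : is_edge_flow) x y : 0 <= x -> x <= y -> y < H + tau ->
  prim uout x <= prim uout y.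
Proof.
move=> x0 xy yH; have := prim_ge_cst (c := 0) (edge_out ef) x0 xy yH.
rewrite mul0r subr_ge0; apply; apply: aeW => s sxy.
by apply: (edge_out_ge0 ef); lra.
Qed.

Lemma prim_out_lip (ef : is_edge_flow) x y :
  tau <= x -> x <= y -> y < H + tau ->
  prim uout y - prim uout x <= nu * (y - x).
Proof.
have [tau0 nu0 H0] := edge_pos ef.
move=> x0 xy yH; apply: (prim_le_cst (edge_out ef)) => //; first lra.
by apply: ae_mono (outflow_le ef) => s h sxy; apply: h; lra.
Qed.

Lemma queue_of0 (ef : is_edge_flow) : z 0 = 0.
Proof. by rewrite /queue_of prim0 !add0r (prim_out_start ef) oppr0. Qed.

Lemma exit_of0 (ef : is_edge_flow) : T 0 = tau.
Proof. by rewrite /exit_of (queue_of0 ef) mul0r !add0r. Qed.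

(** The inflow is nonnegative and the outflow rate is at most [nu]. *)
Lemma queue_of_drop (ef : is_edge_flow) x y : 0 <= x -> x <= y -> y < H ->
  z x - nu * (y - x) <= z y.
Proof.
move=> x0 xy yH; have := prim_in_mono ef x0 xy yH.
have : prim uout (y + tau) - prim uout (x + tau) <= nu * (y - x).
  have -> : y - x = y + tau - (x + tau) by ring.
  by apply: (prim_out_lip ef); lra.
by rewrite /queue_of; lra.
Qed.

Lemma exit_ofE (ef : is_edge_flow) x : nu * (T x - x - tau) = z x.
Proof.
have [tau0 nu0 H0] := edge_pos ef.
by rewrite /exit_of; field; rewrite gt_eqF.
Qed.

Lemma exit_of_ge (ef : is_edge_flow) x : 0 <= x < H -> x + tau <= T x.
Proof.
have [tau0 nu0 H0] := edge_pos ef.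
move=> /(edge_queue_ge0 ef) zx; rewrite /exit_of -addrA lerD2l.
by rewrite lerDr divr_ge0// ltW.
Qed.

(** While time advances by [y - x], the waiting time [z / nu] shrinks by at most as much. *)
Lemma exit_of_mono (ef : is_edge_flow) x y :
  0 <= x -> x <= y -> y < H -> T x <= T y.
Proof.
have [tau0 nu0 H0] := edge_pos ef.
move=> x0 xy yH; rewrite -(ler_pM2l nu0).
have := queue_of_drop ef x0 xy yH; rewrite -!(exit_ofE ef); lra.
Qed.

(** Between [x + tau] and [T x] the edge works at full rate [nu], which releases exactly the amount
    [z x] queued at time [x]. *)
Lemma prim_out_exit (ef : is_edge_flow) x : 0 <= x < H -> T x < H + tau ->
  prim uout (T x) = prim uin x.
Proof.
have [tau0 nu0 H0] := edge_pos ef.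
move=> xH TH; have xT := exit_of_ge ef xH.
have := prim_eq_cst (c := nu) (edge_out ef) _ xT TH.
have -> : T x - (x + tau) = T x - x - tau by ring.
rewrite (exit_ofE ef) /queue_of => h.
(* The queue drops at rate at most [nu], so it is nonempty until [T x - tau]. *)
suff : prim uout (T x) - prim uout (x + tau) = prim uin x - prim uout (x + tau).
  by move/addIr.
apply: h; first lra.
apply: ae_mono (edge_operation ef) => s h sxT; rewrite h; last by lra.
rewrite ifT//; apply: (@lt_le_trans _ _ (z x - nu * (s - tau - x))).
  by rewrite -(exit_ofE ef) -mulrBr; apply: mulr_gt0 => //; lra.
by apply: (queue_of_drop ef); lra.
Qed.

Lemma exit_of_continuous (ef : is_edge_flow) b :
  0 <= b -> b < H -> {within `[0, b], continuous T}.
Proof.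
have [tau0 nu0 H0] := edge_pos ef.
move=> b0 bH; pose e := (b + tau + (H + tau)) / 2.
have c1 := prim_continuous (edge_in ef) b0 bH.
have c2 : {within `[0, b], continuous (fun x => prim uout (x + tau))}.
  apply: (@continuous_comp_shift _ _ _ _ e) => //; first by rewrite /e; lra.
  by apply: (prim_continuous (edge_out ef)); rewrite /e; lra.
apply/subspace_continuousP => x xb; rewrite /exit_of /queue_of.
have {}c1 := (subspace_continuousP _ _).1 c1 x xb.
have {}c2 := (subspace_continuousP _ _).1 c2 x xb.
apply: cvgD; last exact: cvg_cst.
apply: cvgD; first exact: cvg_within_filter.
by apply: cvgMr_tmp; apply: cvgB.
Qed.

(** [c] is the supremum of the entry times that still exit before [H], and continuity forces
    [T c = H]. The alternative is an edge too long to be left before [H], with cutoff 0. *)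
Lemma cutoff (ef : is_edge_flow) : exists c, [/\ 0 <= c < H,
  (forall x, 0 <= x < H -> (T x < H) = (x < c)) &
  (c = 0 /\ H <= tau) \/ T c = H].
Proof.
have [tau0 nu0 H0] := edge_pos ef.
have [Htau|tauH] := leP H tau.
  exists 0; split; [by rewrite lexx|move=> x xH|by left].
  have := exit_of_ge ef xH => ?; apply/idP/idP; lra.
(* From [B] on, the transit time alone delays the exit to [H] or later, so the search is confined to
   [[0, B]], which stays clear of the end of the time domain. *)
pose B := H - tau.
have B0 : 0 <= B by rewrite /B; lra.
have BH : B < H by rewrite /B; lra.
have TB : H <= T B.
  apply: le_trans (exit_of_ge ef _); first by rewrite /B; lra.
  by rewrite B0 BH.
pose S := [set x | 0 <= x <= B /\ T x < H].
have S0 : S 0 by split; [rewrite lexx|rewrite (exit_of0 ef)].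
have ubS : has_ubound S by exists B => y [/andP[_ ->]].
have hsS : has_sup S by split => //; exists 0.
have cT b : 0 <= b -> b < H -> {within `[0, b], continuous T}.
  exact: (exit_of_continuous ef).
exists (sup S); set c := sup S.
have leS y : S y -> y <= c by exact: (ub_le_sup ubS).
have c0 : 0 <= c by exact: leS.
have cB : c <= B by apply: ge_sup => //; [exists 0|move=> y [/andP[]]].
have adh x : x < c -> exists2 y, S y & x < y.
  move=> xc; have [|y Sy] := @sup_adherent _ S (c - x) _ hsS.
    by rewrite subr_gt0.
  by rewrite -/c => ?; exists y => //; lra.
have below x : 0 <= x -> x < c -> T x < H.
  move=> x0 /adh[y [/andP[y0 yB] TyH] xy]; apply: le_lt_trans TyH.
  by apply: (exit_of_mono ef); lra.
(* If [T c > H], some earlier time has an exit time above [H], against [below]; if [T c < H], some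
   time past [c] still belongs to [S]. *)
have Tc : T c = H.
  apply/eqP; rewrite eq_le !leNgt; apply/andP; split; apply/negP => h.
    have [d /[!in_itv]/= /andP[d0 dc] Td] :
        exists2 d, d \in `[0, c] & T d = (H + T c) / 2.
      apply: IVT => //; first by apply: cT => //; lra.
      rewrite (exit_of0 ef) ge_min le_max; apply/andP; split; apply/orP;
        [left|right]; lra.
    have : d < c.
      rewrite lt_neqAle dc andbT; apply/eqP => dE; move: Td; rewrite dE; lra.
    by move=> /(below _ d0); lra.
  have [d /[!in_itv]/= /andP[cd dB] Td] :
      exists2 d, d \in `[c, B] & T d = (T c + H) / 2.
    apply: IVT => //.
      apply: continuous_subspaceW (cT _ B0 BH) => x /=.
      by rewrite !in_itv/=; lra.
    rewrite ge_min le_max; apply/andP; split; apply/orP; [left|right]; lra.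
  have : d <= c by apply: leS; split; lra.
  move=> dc; have dE : d = c by lra.
  by move: Td; rewrite dE; lra.
split; [by lra| |by right].
move=> x xH; apply/idP/idP => h; last by apply: below => //; lra.
rewrite ltNge; apply/negP => cx.
have : T c <= T x by apply: (exit_of_mono ef); lra.
by lra.
Qed.

(** What has left by [t + tau] had entered by [t], and the release rate is at most [nu] from then
    on. *)
Lemma prim_out_cap (ef : is_edge_flow) t : 0 <= t < H ->
  prim uout H <= prim uin t + nu * Num.max 0 (H - t - tau).
Proof.
have [tau0 nu0 H0] := edge_pos ef.
move=> tH; have := edge_queue_ge0 ef tH; rewrite /queue_of.
have [h|h] := leP (t + tau) H.
  rewrite (max_idPr _); last lra.
  have : prim uout H - prim uout (t + tau) <= nu * (H - t - tau).
    have -> : H - t - tau = H - (t + tau) by ring.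
    by apply: (prim_out_lip ef); lra.
  by lra.
rewrite (max_idPl _); last lra.
have : prim uout H <= prim uout (t + tau) by apply: (prim_out_mono ef); lra.
by lra.
Qed.

(** If there were a queue at [t], the outflow would have run at rate [nu] ever since the queue was
    last empty, while the inflow never exceeded [nu]; so the queue could not have grown. *)
Lemma queue_of_eq0 (ef : is_edge_flow) t : 0 <= t < H ->
  {ae leb, forall x, 0 < x < t -> uin x <= nu} -> z t = 0.
Proof.
have [tau0 nu0 H0] := edge_pos ef.
move=> tH in_le; apply/eqP; rewrite eq_le (edge_queue_ge0 ef tH) andbT leNgt.
apply/negP => zt.
pose S := [set x | 0 <= x <= t /\ z x = 0].
have S0 : S 0 by split; [lra|exact: (queue_of0 ef)].
have ubS : has_ubound S by exists t => y [/andP[_ ->]].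
have hsS : has_sup S by split => //; exists 0.
(* [s] is the last time before [t] at which the queue is empty. *)
set s := sup S.
have leS y : S y -> y <= s by exact: (ub_le_sup ubS).
have s0 : 0 <= s by exact: leS.
have st : s <= t by apply: ge_sup => //; [exists 0|move=> y [/andP[]]].
have rise x y : 0 <= x -> x <= y -> y <= t ->
    prim uin y - prim uin x <= nu * (y - x).
  move=> x0 xy yt; apply: (prim_le_cst (edge_in ef)) => //; first lra.
  by apply: ae_mono in_le => r h rxy; apply: h; lra.
(* The supremum is attained: if [z s] were positive, some [y] in [S] would lie within [z s / nu] of
   [s], too close for a queue growing at rate at most [nu] to reach [z s]. *)
have zs : z s = 0.
  apply/eqP; rewrite eq_le (edge_queue_ge0 ef) ?andbT; last lra.
  rewrite leNgt; apply/negP => zs.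
  have [|y [/andP[y0 yt] zy]] := @sup_adherent _ S (z s / nu) _ hsS.
    by rewrite divr_gt0.
  rewrite -/s => sy; have ys : y <= s by apply: leS; split => //; rewrite y0.
  have := rise _ _ y0 ys st.
  have : prim uout (y + tau) <= prim uout (s + tau).
    by apply: (prim_out_mono ef); lra.
  have : nu * (s - y) < z s by rewrite mulrC -ltr_pdivlMr//; lra.
  by move: zy; rewrite /queue_of; lra.
have := rise _ _ s0 st (lexx _).
have : prim uout (t + tau) - prim uout (s + tau) = nu * (t - s).
  have -> : t - s = t + tau - (s + tau) by ring.
  apply: (prim_eq_cst (edge_out ef)); [lra..|].
  apply: ae_mono (edge_operation ef) => x h xst; rewrite h; last lra.
  rewrite ifT// lt_neqAle (edge_queue_ge0 ef) ?andbT; last lra.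
  apply/eqP => z0; have : x - tau <= s by apply: leS; split => //; lra.
  by lra.
by move: zs zt; rewrite /queue_of; lra.
Qed.

(** The equality case of [prim_out_cap]. The outflow has rate [nu] from [t + tau] to [c + tau], and
    the queue left at [c] is [nu * (H - c - tau)] because [T c = H]; it is released exactly by
    [H]. *)
Lemma prim_out_saturated (ef : is_edge_flow) t c :
  0 <= t -> t <= c -> c < H -> T c = H ->
  z t = 0 -> {ae leb, forall x, t < x < c -> nu <= uin x} ->
  prim uout H = prim uin t + nu * (H - t - tau).
Proof.
have [tau0 nu0 H0] := edge_pos ef.
move=> t0 tc cH TcH zt in_ge.
have := exit_ofE ef c.
have : prim uout (T c) = prim uin c.
  by apply: (prim_out_exit ef); rewrite ?TcH; lra.
rewrite TcH => ->.
have : prim uout (c + tau) - prim uout (t + tau) = nu * (c - t).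
  have -> : c - t = c + tau - (t + tau) by ring.
  apply: (prim_eq_cst (edge_out ef)); [lra..|].
  apply: ae_mono2 (edge_operation ef) (ae_shift (- tau) in_ge) => x h g xtc.
  rewrite h; last lra.
  by case: ifPn => // _; apply/min_idPr/g; lra.
by move: zt; rewrite /queue_of; lra.
Qed.

End dynamics.
End edge.

(** * Flow of a single player through an edge under FIFO *)

Section fifo.
Context (R : realType).
Notation leb := (@lebesgue_measure R).
Implicit Types (a b x y : R).

(** By [prim_out_exit], the last entry time [phi] carries the total outflow on [[tau, T b[] to the
    total inflow on [[0, b[]. Integrating the share [vin / uin] against both gives the outflow and
    the inflow of the player. *)
Lemma prim_fifo tau nu H (uin uout vin vout : R -> R) b :
  let T := exit_of tau nu uin uout in
  edge_flow tau nu H uin uout ->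
  leb.-integrable `[0, H[ (EFin \o vin) ->
  leb.-integrable `[0, H + tau[ (EFin \o vout) ->
  (forall x, 0 <= x < H -> 0 <= vin x <= uin x) ->
  (forall x, 0 <= x < H + tau -> 0 <= vout x) ->
  {ae leb, forall x, 0 <= x < tau -> vout x = 0} ->
  {ae leb, forall x, tau <= x < H + tau ->
    forall phi, 0 <= phi < H -> T phi = x ->
      (forall y, 0 <= y < H -> T y = x -> y <= phi) ->
      vout x = vin phi / uin phi * uout x} ->
  0 <= b < H -> T b < H + tau -> prim vout (T b) = prim vin b.
Proof.
move=> T ef iin iout vin0 vout0 start fifo bH TH.
have [tau0 nu0 H0] := edge_pos ef.
have b0 : 0 <= b by lra. have bltH : b < H by lra.
have ndT x y : 0 <= x -> x <= y -> y <= b -> T x <= T y.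
  by move=> x0 xy yb; apply: (exit_of_mono ef) => //; lra.
have [phi [nd_phi phiP]] :=
  nondecreasing_right_inverse b0 (exit_of_continuous ef b0 bltH) ndT.
have T0 : T 0 = tau by exact: exit_of0 ef.
have tauTb : tau <= T b by rewrite -T0; apply: ndT.
rewrite -/T T0 in phiP.
have mphi : measurable_fun [set: R] phi by exact: nondecreasing_measurable.
have mD1 : measurable (`[tau, T b[ : set R) by [].
have mD2 : measurable (`[0, b[ : set R) by [].
have sub1 : `[tau, T b[ `<=` `[0, H + tau[.
  by move=> x /=; rewrite !in_itv/=; lra.
have sub2 : `[0, b[ `<=` `[0, H[ by move=> x /=; rewrite !in_itv/=; lra.
have iuout1 := integrable_sub mD1 sub1 (edge_out ef).
have muin2 : measurable_fun `[0, b[ uin.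
  apply/measurable_EFinP; apply: (measurable_int leb).
  exact: integrable_sub mD2 sub2 (edge_in ef).
have mvin2 : measurable_fun `[0, b[ vin.
  apply/measurable_EFinP; apply: (measurable_int leb).
  exact: integrable_sub mD2 sub2 iin.
pose r x := vin x / uin x.
have mr : measurable_fun `[0, b[ r.
  apply: measurable_funM => //.
  exact: (measurableT_comp (@measurable_inv R)).
have r0 x : `[0, b[%classic x -> 0 <= r x.
  rewrite /= in_itv/= => xb; have := vin0 x; rewrite /r => vx.
  by apply: divr_ge0; lra.
have phiD x : `[tau, T b[%classic x -> `[0, b[%classic (phi x).
  by rewrite /= !in_itv/= => /andP[x1 x2]; case: (phiP _ x1 x2).
(* Entering before [a] amounts to leaving before [T a], and [prim_out_exit] at [a] equates the two
   amounts. *)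
have rays_in a : 0 <= a <= b ->
    (\int[leb]_(x in `[tau, T b[ `&` phi @^-1` `]-oo, a[) (uout x)%:E =
     \int[leb]_(x in `[0%R, b[ `&` `]-oo, a[) (uin x)%:E)%E.
  move=> ab; have Tab : T a <= T b by apply: ndT; lra.
  have tauTa : tau <= T a by rewrite -T0; apply: ndT; lra.
  have -> : `[tau, T b[ `&` phi @^-1` `]-oo, a[ = `[tau, T a[%classic.
    apply/seteqP; split => x /=; rewrite !in_itv/=.
      move=> [/andP[x1 x2]]; have [_ _ _ ->//] := phiP _ x1 x2.
      by rewrite x1.
    move=> /andP[x1 x2]; have x3 : x < T b by lra.
    by rewrite x1 x3; have [_ _ _ ->] := phiP _ x1 x3.
  have -> : `[0, b[ `&` `]-oo, a[ = `[0, a[%classic.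
    by apply/seteqP; split => x /=; rewrite !in_itv/=; lra.
  rewrite (integral_itv_prim (edge_out ef))//; [|lra..].
  rewrite (integral_itv_prim (edge_in ef))//; [|lra..].
  rewrite (prim_out_start ef) prim0 !subr0.
  by rewrite (prim_out_exit ef)//; rewrite -?/(T a); lra.
have rays a :
    (\int[leb]_(x in `[tau, T b[ `&` phi @^-1` `]-oo, a[) (uout x)%:E =
     \int[leb]_(x in `[0%R, b[ `&` `]-oo, a[) (uin x)%:E)%E.
  have [a0|a0] := ltP a 0.
    have -> : `[tau, T b[ `&` phi @^-1` `]-oo, a[ = set0.
      by apply/seteqP; split => x //= [/phiD /=]; rewrite !in_itv/=; lra.
    have -> : `[0, b[ `&` `]-oo, a[ = set0.
      by apply/seteqP; split => x //= []; rewrite !in_itv/=; lra.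
    by rewrite !integral_set0.
  have [ab|ba] := leP a b; first by apply: rays_in; rewrite a0.
  have <- : `[tau, T b[ `&` phi @^-1` `]-oo, b[ =
            `[tau, T b[ `&` phi @^-1` `]-oo, a[.
    apply/seteqP; split => x /= [xT]; have := phiD x xT; rewrite /= !in_itv/=;
      by split => //; lra.
  have -> : `[0, b[ `&` `]-oo, a[ = `[0, b[ `&` `]-oo, b[.
    by apply/seteqP; split => x /=; rewrite !in_itv/=; lra.
  by apply: rays_in; rewrite b0 lexx.
have uin0 x : `[0, b[%classic x -> 0 <= uin x.
  by rewrite /= in_itv/= => xb; apply: (edge_in_ge0 ef); lra.
have uout0 x : `[tau, T b[%classic x -> 0 <= uout x.
  by move=> /sub1; rewrite /= in_itv/=; exact: (edge_out_ge0 ef).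
have muout1 : measurable_fun `[tau, T b[ uout.
  by apply/measurable_EFinP; exact: (measurable_int leb).
have mvout1 : measurable_fun `[tau, T b[ vout.
  apply/measurable_EFinP; apply: (measurable_int leb).
  exact: integrable_sub mD1 sub1 iout.
have := ge0_integral_transport mD1 mD2 iuout1 muin2 uout0 uin0 mphi phiD rays
  mr r0.
have -> : (\int[leb]_(x in `[tau, T b[) (r (phi x) * uout x)%:E =
           \int[leb]_(x in `[tau, T b[) (vout x)%:E)%E.
  apply: ge0_ae_eq_integral => //.
  - apply/measurable_EFinP/measurable_funM => //.
    apply: (measurable_comp mD2 _ mr); first by move=> _ [x /phiD ? <-].
    exact: measurable_funTS.
  - exact/measurable_EFinP.
  - by move=> x xD; rewrite lee_fin mulr_ge0 ?r0 ?uout0//; exact: phiD.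
  - move=> x /sub1; rewrite /= in_itv/= => xD.
    by rewrite lee_fin vout0.
  apply: ae_mono fifo => x h; rewrite /= in_itv/= => /andP[x1 x2].
  have [pb Tp maxp _] := phiP _ x1 x2.
  rewrite (h _ (phi x))//; [lra|lra|].
  (* [phi x] is the last preimage within [[0, b]] only; entries after [b] exit at [T b] or later,
     hence after [x]. *)
  move=> y yH Ty; have [yb|yb] := leP y b; first by apply: maxp => //; lra.
  have : T b <= T y by apply: (exit_of_mono ef) => //; lra.
  by rewrite Ty leNgt x2.
have -> : (\int[leb]_(x in `[0%R, b[) (r x * uin x)%:E =
           \int[leb]_(x in `[0%R, b[) (vin x)%:E)%E.
  (* Where [uin] vanishes, so does [vin], so the default value of the quotient does no harm. *)
  apply: eq_integral => x; rewrite inE/= in_itv/= => xb; congr EFin.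
  have := vin0 x; rewrite /r; have [->|u0 _] := eqVneq (uin x) 0.
    by rewrite mulr0; lra.
  by rewrite divfK.
rewrite (integral_itv_prim iout)//; last lra.
rewrite (integral_itv_prim iin)// prim0 subr0 => -[<-].
suff -> : prim vout tau = 0 by rewrite subr0.
have := prim_eq_cst (c := 0) iout (lexx 0) (ltW tau0).
rewrite prim0 mul0r subr0; apply; first by lra.
by apply: ae_mono start => x h xt; apply: h; lra.
Qed.
End fifo.

(** * Feasible flows *)

Section flows.
Context (R : realType) (E P : finType).
Variables (tau nu : E -> R) (d : P -> R) (H : R).
Notation leb := (@lebesgue_measure R).
Notation exit := (exit_time tau nu).
Implicit Types (f : flow R E P) (e : E) (i j : P) (t x y : R).

Lemma ae_forall_fin (I : finType) (Q : I -> R -> Prop) :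
  (forall k, {ae leb, forall x, Q k x}) -> {ae leb, forall x, forall k, Q k x}.
Proof.
move=> aeQ.
suff h (s : seq I) : {ae leb, forall x, forall k, k \in s -> Q k x}.
  apply: ae_mono (h (index_enum I)) => x Qs k.
  by apply: Qs; rewrite mem_index_enum.
elim: s => [|l s IH]; first by apply: aeW => x k.
apply: ae_mono2 (aeQ l) IH => x Ql Qs k; rewrite inE => /predU1P[->//|].
exact: Qs.
Qed.

Definition positive_data :=
  [/\ forall e, 0 < tau e, forall e, 0 < nu e & 0 < H].

Notation edge f e :=
  (edge_flow (tau e) (nu e) H (total_inflow f e) (total_outflow f e)).

Lemma total_queueE f e x : flow_over_time tau H f -> 0 < tau e -> 0 <= x < H ->
  queue tau f e x = queue_of (tau e) (total_inflow f e) (total_outflow f e) x.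
Proof.
move=> fo te xH; rewrite /queue /queue_of /cum_inflow /cum_outflow.
congr (_ - _).
  apply: (prim_sum (B := H)); last by lra.
  by move=> j; case: (fo e j).
apply: (prim_sum (B := H + tau e)); last by lra.
by move=> j; case: (fo e j).
Qed.

Lemma exit_timeE f e x : flow_over_time tau H f -> 0 < tau e -> 0 <= x < H ->
  exit f e x = exit_of (tau e) (nu e) (total_inflow f e) (total_outflow f e) x.
Proof. by move=> fo te xH; rewrite /exit_time total_queueE. Qed.

Lemma queue_ge0 f e x : no_deficit tau H f -> 0 <= x < H ->
  0 <= queue tau f e x.
Proof.
move=> nd xH; rewrite /queue -sumrB; apply: sumr_ge0 => j _.
exact: nd.
Qed.

(** Every exit time is at least [tau e], so before [tau e] there is no last entry and the second
    clause of [fifo_operation] applies. *)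
Lemma outflow_start f e j : positive_data -> feasible tau nu d H f ->
  {ae leb, forall x, 0 <= x < tau e -> outflow f e j x = 0}.
Proof.
move=> [tau0 nu0 H0] [fo _ nd _ fifo].
apply: ae_mono (fifo e j) => x h xt; have te := tau0 e.
apply: (h _).2; first lra.
move=> [phi [[[phiH phix] _] _]]; move: phix; rewrite /exit_time => phix.
have : 0 <= queue tau f e phi / nu e by rewrite divr_ge0 ?queue_ge0// ltW.
by lra.
Qed.

Lemma feasible_edge_flow f e :
  positive_data -> feasible tau nu d H f -> edge f e.
Proof.
move=> pos fe; have [tau0 nu0 H0] := pos; have [fo _ nd qo fifo] := fe.
have te := tau0 e.
split; first by split.
- by apply: integrable_sumr => // j; case: (fo e j).
- by apply: integrable_sumr => // j; case: (fo e j).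
- by move=> x xH; apply: sumr_ge0 => j _; case: (fo e j) => _ _ + _; exact.
- by move=> x xH; apply: sumr_ge0 => j _; case: (fo e j) => _ _ _; exact.
- by move=> x xH; rewrite -total_queueE//; exact: queue_ge0.
- apply: ae_mono (ae_forall_fin (fun j => outflow_start e j pos fe)) => x h xt.
  by rewrite /total_outflow big1// => j _; exact: h.
- apply: ae_mono (ae_shift (- tau e) (qo e)) => x h xt.
  by rewrite -total_queueE//; [rewrite -h ?subrK//; lra|lra].
Qed.

Lemma cum_outflow_exit f e j b : positive_data -> feasible tau nu d H f ->
  0 <= b < H -> exit f e b < H + tau e ->
  cum_outflow f e j (exit f e b) = cum_inflow f e j b.
Proof.
move=> pos fe bH; have [tau0 nu0 H0] := pos; have [fo _ nd qo fifo] := fe.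
have te := tau0 e; rewrite exit_timeE// => TH.
have [iin iout in0 out0] := fo e j.
apply: (prim_fifo (feasible_edge_flow e pos fe) iin iout _ out0 _ _ bH TH).
- move=> x xH; rewrite in0//= /total_inflow (bigD1 j)//= lerDl.
  by apply: sumr_ge0 => k _; case: (fo e k) => _ _ + _; exact.
- exact: outflow_start.
- apply: ae_mono (fifo e j) => x h xt phi phiH Tphi maxphi.
  have lphi : last_entry tau nu H f e x phi.
    split; first by split => //; rewrite exit_timeE.
    by move=> y [yH]; rewrite exit_timeE//; exact: maxphi.
  have [|h1 h2] := h _; first lra.
  (* With no total inflow at the last entry time, the second clause of [fifo_operation] gives
     outflow 0, which matches the quotient by 0; the last entry time is unique, so no other one can
     have positive inflow. *)
  have [tot0|tot0] := ltP 0 (total_inflow f e phi); first exact: h1.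
  have -> : total_inflow f e phi = 0.
    apply/eqP; rewrite eq_le tot0 (edge_in_ge0 (feasible_edge_flow e pos fe))//.
  rewrite invr0 mulr0 mul0r h2// => -[y [[yp yu] ty]].
  have [pp pu] := lphi.
  have yphi : y = phi by apply/eqP; rewrite eq_le pu//= yu.
  by move: ty; rewrite yphi ltNge tot0.
Qed.

Lemma exists_cutoff f : positive_data -> feasible tau nu d H f ->
  exists c : E -> R, forall e, [/\ 0 <= c e < H,
    (forall x, 0 <= x < H -> (exit f e x < H) = (x < c e)),
    (forall j, cum_outflow f e j H = cum_inflow f e j (c e)) &
    0 < c e -> exit f e (c e) = H].
Proof.
move=> pos fe; have [tau0 nu0 H0] := pos; have [fo _ nd qo fifo] := fe.
suff h e : exists c, [/\ 0 <= c < H,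
    (forall x, 0 <= x < H -> (exit f e x < H) = (x < c)),
    (forall j, cum_outflow f e j H = cum_inflow f e j c) &
    0 < c -> exit f e c = H].
  by have [c cP] := choice h; exists c.
have te := tau0 e.
have [c [cH Tc cH']] := cutoff (feasible_edge_flow e pos fe).
exists c; split => //.
- by move=> x xH; rewrite exit_timeE// Tc.
(* On an edge with [H <= tau e] both sides are 0; otherwise [H] is the exit time of the cutoff and
   [cum_outflow_exit] applies. *)
- move=> j; case: cH' => [[c0 Hte]|TcH].
    rewrite c0 /cum_inflow -/(prim _ _) prim0.
    have [_ iout _ _] := fo e j.
    have := prim_eq_cst (c := 0) iout (lexx 0) (ltW H0).
    rewrite prim0 mul0r subr0; apply; first by lra.
    by apply: ae_mono (outflow_start e j pos fe) => x h xt; apply: h; lra.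
  rewrite -exit_timeE// in TcH.
  by rewrite -(cum_outflow_exit j pos fe cH) TcH//; lra.
- move=> c0; case: cH' => [[c0' _]|]; first by move: c0; rewrite c0' ltxx.
  by rewrite exit_timeE.
Qed.

Lemma sum_cum_inflow f j b :
  supply_constraint d H f -> flow_over_time tau H f ->
  0 <= b < H -> \sum_e cum_inflow f e j b = d j * b.
Proof.
move=> sc fo bH; rewrite /cum_inflow.
have iin e : leb.-integrable `[0, H[ (EFin \o inflow f e j) by case: (fo e j).
rewrite (prim_sum iin); last lra.
have := prim_eq_cst (c := d j) (integrable_sumr _ iin) (lexx 0) (b := b).
rewrite prim0 !subr0; apply => //; [lra|lra|].
by apply: ae_mono (sc j) => x h xb; apply: h; lra.
Qed.

Lemma cum_inflow_mono f e j x y : flow_over_time tau H f ->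
  0 <= x -> x <= y -> y < H -> cum_inflow f e j x <= cum_inflow f e j y.
Proof.
move=> fo x0 xy yH; have [iin _ in0 _] := fo e j.
have := prim_ge_cst (c := 0) iin x0 xy yH.
rewrite mul0r subr_ge0; apply; apply: aeW => s sxy.
by apply: in0; lra.
Qed.

End flows.

(** * Proportional play and maximal throughput *)

Section proportional.
Context (R : realType) (E P : finType).
Variables (tau nu : E -> R) (d : P -> R) (H : R).
Notation leb := (@lebesgue_measure R).
Notation exit := (exit_time tau nu).
Notation positive_data := (positive_data tau nu H).
Implicit Types (f : flow R E P) (e : E) (i j : P) (t x y : R) (c : E -> R).

Definition cutoffs f c := forall e, [/\ 0 <= c e < H,
  (forall x, 0 <= x < H -> (exit f e x < H) = (x < c e)),
  (forall j, cum_outflow f e j H = cum_inflow f e j (c e)) &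
  0 < c e -> exit f e (c e) = H].

Definition last_cutoff c m := (forall e, c e <= m) /\ exists e, c e = m.

(** Stated for one player, so that it also covers the players who stay proportional when another one
    deviates. *)
Definition plays_proportionally f i := forall e,
  {ae leb, forall x, 0 <= x < H -> inflow f e i x =
  proportional_strategy nu H x (fun e' => exit f e' x) e * d i}.

Lemma exists_last_cutoff c : (0 < #|E|)%N -> exists m, last_cutoff c m.
Proof.
move=> /card_gt0P[e0 _].
pose e1 := [arg max_(e > e0) c e]%O; exists (c e1); split; last by exists e1.
by rewrite /e1; case: Order.TotalTheory.arg_maxP => // e _ h k; exact: h.
Qed.

(** Before [m] the edge with the largest cutoff is still useful, so the last branch of
    [proportional_strategy] never occurs. *)
Lemma proportional_inflow f i e c m : cutoffs f c -> last_cutoff c m ->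
  plays_proportionally f i ->
  {ae leb, forall x, 0 <= x < m -> inflow f e i x =
    (if x < c e then nu e / \sum_(e' | x < c e') nu e' else 0) * d i}.
Proof.
move=> fc [cm [e1 ce1]] /(_ e); apply: ae_mono => x h xm.
have mH : m < H by rewrite -ce1; case: (fc e1) => /andP[].
have xH : 0 <= x < H by lra.
have exitE e' : (exit f e' x < H) = (x < c e') by case: (fc e') => _ ->.
rewrite h// /proportional_strategy exitE.
case: ifPn => _.
  by under eq_bigl do rewrite exitE.
case: ifPn => //; rewrite negb_exists => /forallP/(_ e1).
by rewrite exitE ce1; lra.
Qed.

(** Between [c e] and [m], edge [e] is useless while another edge is not, so a proportional player
    sends nothing into [e]. *)
Lemma cum_inflow_cutoff f i e c m t : flow_over_time tau H f ->
  cutoffs f c -> last_cutoff c m -> plays_proportionally f i ->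
  c e <= t <= m -> cum_inflow f e i (c e) = cum_inflow f e i t.
Proof.
move=> fo fc cm pi ctm; have [ceH _ _ _] := fc e.
have [e1 ce1] := cm.2; have [ce1H _ _ _] := fc e1; rewrite ce1 in ce1H.
have [iin _ _ _] := fo e i; apply/esym/eqP; rewrite -subr_eq0; apply/eqP.
rewrite -[RHS](mul0r (t - c e)); apply: (prim_eq_cst iin); [lra..|].
apply: ae_mono (proportional_inflow e fc cm pi) => x h xt.
rewrite h; last by lra.
by rewrite ifF ?mul0r//; apply/negbTE; rewrite -leNgt; lra.
Qed.

Lemma payoffE f j c : cutoffs f c ->
  payoff H f j = \sum_e cum_inflow f e j (c e).
Proof. by move=> fc; apply: eq_bigr => e _; case: (fc e) => _ _ ->. Qed.

(** Only what enters [e] before [c e <= m] counts, and the supply of [j] up to [m] is [d j * m]. *)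
Lemma payoff_le f j c m :
  feasible tau nu d H f -> cutoffs f c -> last_cutoff c m ->
  payoff H f j <= d j * m.
Proof.
move=> [fo sc _ _ _] fc [cm [e1 ce1]].
have [] := fc e1; rewrite ce1 => mH _ _ _.
rewrite (payoffE _ fc) -(sum_cum_inflow _ sc fo)//.
apply: ler_sum => e _; have [ceH _ _ _] := fc e.
by apply: (cum_inflow_mono _ _ fo); [lra|exact: cm|lra].
Qed.

(** The equality case of [payoff_le]: nothing that a proportional player sends before [m] arrives
    too late. *)
Lemma payoff_proportional f i c m : feasible tau nu d H f -> cutoffs f c ->
  last_cutoff c m -> plays_proportionally f i -> payoff H f i = d i * m.
Proof.
move=> [fo sc _ _ _] fc cm pi.
have [e1 ce1] := cm.2; have [] := fc e1; rewrite ce1 => mH _ _ _.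
rewrite (payoffE _ fc) -(sum_cum_inflow _ sc fo)//.
apply: eq_bigr => e _; apply: (cum_inflow_cutoff fo fc cm pi).
by rewrite lexx cm.1.
Qed.

Lemma sum_payoff f : flow_over_time tau H f -> (forall e, 0 < tau e) ->
  \sum_j payoff H f j = \sum_e prim (total_outflow f e) H.
Proof.
move=> fo tau0; rewrite exchange_big/=; apply: eq_bigr => e _.
apply: (prim_sum (B := H + tau e)); last by rewrite ltrDl.
by move=> j; case: (fo e j).
Qed.

Lemma sum_total_inflow f t : feasible tau nu d H f -> 0 <= t < H ->
  \sum_e prim (total_inflow f e) t = (\sum_j d j) * t.
Proof.
move=> [fo sc _ _ _] tH; rewrite mulr_suml.
under [RHS]eq_bigr do rewrite -(sum_cum_inflow _ sc fo tH).
rewrite exchange_big/=; apply: eq_bigr => e _; apply/esym.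
apply: (prim_sum (B := H)); last lra.
by move=> j; case: (fo e j).
Qed.

(* What enters before [t], plus what the edges can still release from
   [t + tau e] to [H]. *)
Definition capacity t :=
  (\sum_j d j) * t + \sum_e nu e * Num.max 0 (H - t - tau e).

Lemma sum_payoff_le f t : positive_data -> feasible tau nu d H f ->
  0 <= t < H -> \sum_j payoff H f j <= capacity t.
Proof.
move=> pos fe tH; have [tau0 _ _] := pos; have [fo _ _ _ _] := fe.
rewrite sum_payoff// /capacity -(sum_total_inflow fe tH) -big_split/=.
apply: ler_sum => e _.
exact: (prim_out_cap (feasible_edge_flow e pos fe)).
Qed.

Lemma antitone_threshold (V : R -> R) (D m : R) : 0 <= m ->
  (forall x y, x <= y -> V y <= V x) ->
  exists t, [/\ 0 <= t <= m, (forall x, 0 <= x < t -> D <= V x) &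
    (forall x, t < x < m -> V x <= D)].
Proof.
(* The point 0 keeps [S] nonempty when [V] is below [D] throughout; the threshold is then 0. *)
move=> m0 anti; pose S := [set x | x = 0 \/ (0 <= x < m /\ D <= V x)].
have ubS : has_ubound S by exists m => y [->//|[/andP[_ /ltW]]].
have S0 : S 0 by left.
have hsS : has_sup S by split => //; exists 0.
have supS0 : 0 <= sup S by exact: (ub_le_sup ubS).
exists (sup S); split.
- apply/andP; split => //.
  by apply: ge_sup => //; [exists 0|move=> y [->//|[/andP[_ /ltW]]]].
- move=> x /andP[x0 xS].
  have [|y Sy] := @sup_adherent _ S (sup S - x) _ hsS.
    by rewrite subr_gt0.
  rewrite opprB addrC subrK => xy.
  case: Sy => [y0|[_ Dy]]; first by move: xy; rewrite y0; lra.
  by apply: (le_trans Dy); apply: anti; exact: ltW.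
- move=> x /andP[Sx xm]; rewrite leNgt; apply/negP => DV.
  suff : x <= sup S by lra.
  apply: (ub_le_sup ubS); right.
  by split; [rewrite xm andbT; lra|exact: ltW].
Qed.

(** At a well-chosen [t], every edge separately attains the bound of [prim_out_cap]. *)
Lemma sum_payoff_proportional f c m : positive_data -> (forall j, 0 < d j) ->
  feasible tau nu d H f -> cutoffs f c -> last_cutoff c m ->
  (forall i, plays_proportionally f i) ->
  exists2 t, 0 <= t < H & \sum_j payoff H f j = capacity t.
Proof.
move=> pos d0 fe fc cm pp.
have [tau0 nu0 H0] := pos; have [fo sc _ _ _] := fe.
have [e1 ce1] := cm.2; have [] := fc e1; rewrite ce1 => mH _ _ _.
pose D := \sum_j d j; have D0 : 0 <= D by apply: sumr_ge0 => j _; exact: ltW.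
pose V x := \sum_(e | x < c e) nu e.
have V_anti x y : x <= y -> V y <= V x.
  move=> xy; rewrite /V big_mkcond [leRHS]big_mkcond/=; apply: ler_sum => e _.
  case: ifPn => [yc|_]; first by rewrite (le_lt_trans xy yc).
  by case: ifPn => // _; exact: ltW.
have V0 x : x < m -> 0 < V x.
  move=> xm; rewrite /V (bigD1 e1)/= ?ce1//; apply: ltr_pwDl => //.
  by apply: sumr_ge0 => e _; exact: ltW.
have total_inflowE e : {ae leb, forall x, 0 <= x < m ->
    total_inflow f e x = if x < c e then nu e * (D / V x) else 0}.
  apply: ae_mono (ae_forall_fin (fun i => proportional_inflow e fc cm (pp i))).
  move=> x h xm; rewrite /total_inflow; under eq_bigr => i _ do rewrite h//.
  rewrite -mulr_sumr -/D -/(V x); case: ifPn => _; last by rewrite mul0r.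
  by rewrite mulrAC mulrA.
have m0 : 0 <= m by lra.
(* [t] is the time from which the supply exceeds the capacity of the useful
   edges. *)
have [t [t0m tV Vt]] := antitone_threshold D m0 V_anti.
have tH : 0 <= t < H by lra.
exists t => //; rewrite sum_payoff// /capacity -(sum_total_inflow fe tH).
rewrite -big_split/=; apply: eq_bigr => e _.
have ef := feasible_edge_flow e pos fe; have te := tau0 e; have ne := nu0 e.
have [ceH exitc outc exitH] := fc e.
(* Before [t] the supply fits: a useful edge receives [nu e * (D / V x)] with [D <= V x], so no
   queue forms. *)
have zt : queue_of (tau e) (total_inflow f e) (total_outflow f e) t = 0.
  apply: (queue_of_eq0 ef tH); apply: ae_mono (total_inflowE e) => x h xt.
  rewrite h; last by lra.
  case: ifPn => _; last exact: ltW.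
  rewrite ger_pMr// ler_pdivrMr ?mul1r; first by apply: tV; lra.
  by apply: V0; lra.
have exit_t : exit f e t = t + tau e.
  by rewrite (exit_timeE nu fo te tH) /exit_of zt mul0r addr0.
(* If [e] is useless at [t], its empty queue gives [H <= t + tau e], so its term in [capacity] is 0;
   and it receives nothing between [c e] and [t]. *)
have [cet|tce] := leP (c e) t.
  have : ~~ (exit f e t < H) by rewrite exitc// -leNgt.
  rewrite exit_t -leNgt => Ht.
  rewrite (max_idPl _) ?mulr0 ?addr0; last by lra.
  rewrite -(prim_sum (B := H + tau e)); last 2 first.
  - by move=> j; case: (fo e j).
  - by lra.
  rewrite -(prim_sum (B := H)); last 2 first.
  - by move=> j; case: (fo e j).
  - by lra.
  apply: eq_bigr => j _; rewrite -[LHS]/(cum_outflow f e j H) outc.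
  by apply: (cum_inflow_cutoff fo fc cm (pp j)); rewrite cet; lra.
have : exit f e t < H by rewrite exitc.
rewrite exit_t => Ht.
rewrite (max_idPr _); last by lra.
have exH : exit f e (c e) = H by apply: exitH; lra.
rewrite (exit_timeE nu fo te ceH) in exH.
have cem := cm.1 e.
(* Between [t] and [c e] one has [V x <= D], so the inflow rate of [e] is at least [nu e]. *)
apply: (prim_out_saturated ef _ _ _ exH zt); [lra..|].
apply: ae_mono (total_inflowE e) => x h xt.
rewrite h; last by lra.
rewrite ifT; last by lra.
rewrite ler_pMr// ler_pdivlMr ?mul1r; first by apply: Vt; lra.
by apply: V0; lra.
Qed.

End proportional.

(** * The equilibrium *)

Section strategies.
Context (R : realType) (E : finType).
Variables (nu : E -> R) (H : R).

Lemma proportional_is_simplex (nu0 : forall e, 0 < nu e) (hE : (0 < #|E|)%N)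
    x (T : E -> R) :
  (forall e, 0 <= proportional_strategy nu H x T e <= 1) /\
  \sum_e proportional_strategy nu H x T e = 1.
Proof.
have pos (A : pred E) e : A e -> 0 < \sum_(k | A k) nu k.
  move=> Ae; rewrite (bigD1 e)//=; apply: ltr_pwDl => //.
  by apply: sumr_ge0 => k _; exact: ltW.
have ge0 e : 0 <= proportional_strategy nu H x T e.
  rewrite /proportional_strategy; case: ifPn => _; last case: ifPn => // _.
    by rewrite divr_ge0// ?sumr_ge0// => *; exact: ltW.
  by rewrite divr_ge0// ?sumr_ge0// => *; exact: ltW.
have sum1 : \sum_e proportional_strategy nu H x T e = 1.
  have [/existsP[e1 Te1]|noE] := boolP [exists e, T e < H].
    have sum_gt0 := pos (fun e => T e < H) e1 Te1.
    rewrite -[RHS](divff (lt0r_neq0 sum_gt0)) mulr_suml [RHS]big_mkcond/=.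
    apply: eq_bigr => e _; rewrite /proportional_strategy; case: ifPn => // _.
    by rewrite ifT//; apply/existsP; exists e1.
  move/card_gt0P : (hE) => [e0 _]; have sum_gt0 := pos xpredT e0 isT.
  rewrite -[RHS](divff (lt0r_neq0 sum_gt0)) mulr_suml; apply: eq_bigr => e _.
  rewrite /proportional_strategy (negbTE noE) ifF//; apply/negbTE.
  by move: noE; rewrite negb_exists => /forallP.
split => // e; rewrite ge0 -sum1 (bigD1 e)//= lerDl.
by apply: sumr_ge0 => k _.
Qed.

(** Exit times are only perturbed upwards: [T e >= H] persists, and so does the strict [T e < H]
    under small increments. The set of useful edges, hence the strategy, is constant to the
    right. *)
Lemma proportional_right_lipschitz e :
  right_lipschitz H (fun x T => proportional_strategy nu H x T e).
Proof.
move=> x T _.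
have [eps eps0 Teps] :
    exists2 eps, 0 < eps & forall k, T k < H -> T k + eps < H.
  suff h (s : seq E) : exists2 eps, 0 < eps &
      forall k, k \in s -> T k < H -> T k + eps < H.
    have [eps eps0 h'] := h (index_enum E).
    by exists eps => // k; apply: h'; rewrite mem_index_enum.
  (* The margin is half the smallest gap [H - T k] over useful edges, capped by 1. *)
  elim: s => [|k s [eps eps0 IH]]; first by exists 1.
  have [TH|HT] := ltP (T k) H; last first.
    exists eps => // l; rewrite inE => /predU1P[->|/IH//].
    by rewrite ltNge HT.
  exists (Num.min eps ((H - T k) / 2)).
    by rewrite lt_min eps0/=; lra.
  move=> l; rewrite inE => /predU1P[-> _|ls Tl].
    have : Num.min eps ((H - T k) / 2) <= (H - T k) / 2.
      by rewrite ge_min lexx orbT.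
    by lra.
  have : Num.min eps ((H - T k) / 2) <= eps by rewrite ge_min lexx.
  by have := IH _ ls Tl; lra.
exists 1, eps; split => // x0 dT _ dT_eps _.
have active k : (T k + dT k < H) = (T k < H).
  have := dT_eps k => dTk; apply/idP/idP => h; first by lra.
  by have := Teps _ h; lra.
rewrite (_ : proportional_strategy nu H (x + x0) _ e =
             proportional_strategy nu H x T e).
  by rewrite subrr normr0 mul1r sqrtr_ge0.
rewrite /proportional_strategy active (eq_bigl _ _ active).
by rewrite (eq_existsb active).
Qed.

End strategies.

Theorem theorem5 (R : realType) (E P : finType)
    (tau nu : E -> R) (d : P -> R) (H : R)
    (hE : (0 < #|E|)%N)
    (htau : forall e : E, 0 < tau e)
    (hnu : forall e : E, 0 < nu e)
    (hd : forall j : P, 0 < d j)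
    (hH : 0 < H) :
  nash_equilibrium tau nu d H
    (fun _ : P => proportional_strategy nu H).
Proof.
have pos : positive_data tau nu H by [].
split.
  move=> j; split; last by move=> e; exact: proportional_right_lipschitz.
  by move=> x T _; exact: proportional_is_simplex.
move=> j s _ f f' [fe playf] [fe' playf'].
have [c fc] := exists_cutoff pos fe; have [c' fc'] := exists_cutoff pos fe'.
have [m cm] := exists_last_cutoff c hE.
have [m' cm'] := exists_last_cutoff c' hE.
have propf i : plays_proportionally tau nu d H f i by move=> e; exact: playf.
have propf' i : i != j -> plays_proportionally tau nu d H f' i.
  by move=> ij e; have := playf' e i; rewrite /deviation (negbTE ij).
have payf i : payoff H f i = d i * m.
  exact: payoff_proportional fe fc cm (propf i).
have payf' i : i != j -> payoff H f' i = d i * m'.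
  by move=> ij; exact: payoff_proportional fe' fc' cm' (propf' i ij).
have payj' : payoff H f' j <= d j * m' by exact: payoff_le fe' fc' cm'.
have [m'm|mm'] := leP m' m.
  by apply: (le_trans payj'); rewrite payf ler_pM2l.
(* The time [t] comes from [f], which attains [capacity t]; the same bound at this [t] holds for
   [f']. *)
have [t tH ft] := sum_payoff_proportional pos hd fe fc cm propf.
have := sum_payoff_le pos fe' tH; rewrite -ft (bigD1 j)//= [leRHS](bigD1 j)//=.
have : \sum_(i | i != j) payoff H f i <= \sum_(i | i != j) payoff H f' i.
  by apply: ler_sum => i ij; rewrite payf payf'// ler_pM2l// ltW.
by lra.
Qed.
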